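(* Let $\mathcal{X}$ be a real Banach space with $\dim(\mathcal{X})\ge 2$ and let $\kappa,\tau>0$. Then $$\min\{\kappa,\tau\}\,\mathcal{T}(\mathcal{X})\le \mathcal{T}_1(\kappa,\tau,\mathcal{X})\le \max\{\kappa,\tau\}\,\mathcal{T}(\mathcal{X}).$$
   Context: $S_{\mathcal{X}}$ denotes the unit sphere of $\mathcal{X}$. Define $$\mathcal{T}(\mathcal{X})=\sup_{x_1,x_2\in S_{\mathcal{X}}}\big(\|x_1+x_2\|\,\|x_1-x_2\|\big)^{1/2},$$ and, for $\kappa,\tau>0$, $$\mathcal{T}_1(\kappa,\tau,\mathcal{X})=\sup_{x_1,x_2\in S_{\mathcal{X}}}\big(\|\kappa x_1+\tau x_2\|\,\|\kappa x_1-\tau x_2\|\big)^{1/2}.$$ *)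

(* Defs.v *)
From HB Require Import structures.
From mathcomp Require Import all_boot all_order all_algebra.
From mathcomp Require Import all_classical all_reals all_analysis.
Set Implicit Arguments.
Unset Strict Implicit.
Unset Printing Implicit Defensive.
Import Order.TTheory GRing.Theory Num.Theory.
Import numFieldNormedType.Exports.
Local Open Scope classical_set_scope.
Local Open Scope ring_scope.

Definition lin_indep (R : realType) (X : lmodType R) (n : nat)
    (v : 'I_n -> X) : Prop :=
  forall c : 'I_n -> R, \sum_(i < n) c i *: v i = 0 -> forall i, c i = 0.

(* X may be infinite-dimensional. *)
Definition dim_ge (R : realType) (X : lmodType R) (n : nat) : Prop :=
  exists v : 'I_n -> X, lin_indep v.

Definition unit_sphere (R : realType) (X : normedModType R) : set X :=
  [set x | `|x| = 1].
Arguments unit_sphere {R} X.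

Definition T_values (R : realType) (X : normedModType R) : set R :=
  [set Num.sqrt (`|x.1 + x.2| * `|x.1 - x.2|) |
     x in unit_sphere X `*` unit_sphere X].

Definition T1_values (R : realType) (k t : R) (X : normedModType R) : set R :=
  [set Num.sqrt (`|k *: x.1 + t *: x.2| * `|k *: x.1 - t *: x.2|) |
     x in unit_sphere X `*` unit_sphere X].

(* The real-valued [sup] is a junk value on sets that are empty or unbounded
   above; [has_sup_T_values] and [has_sup_T1_values] below rule both out as soon
   as X is nontrivial. *)
Definition T_const (R : realType) (X : normedModType R) : R :=
  sup (T_values X).

Definition T1_const (R : realType) (k t : R) (X : normedModType R) : R :=
  sup (T1_values k t X).

Lemma has_sup_T1_values (R : realType) (k t : R) (X : normedModType R) :
  unit_sphere X !=set0 -> has_sup (T1_values k t X).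
Proof.
move=> [x Sx]; split; first by eexists; exists (x, x).
exists (`|k| + `|t|) => _ [[y z] [/= Sy Sz] <-].
rewrite -[leRHS]ger0_norm ?addr_ge0// -sqrtr_sqr ler_sqrt ?sqr_ge0// expr2.
have nk : `|k *: y| = `|k| by rewrite normrZ Sy mulr1.
have nt : `|t *: z| = `|t| by rewrite normrZ Sz mulr1.
by apply: ler_pM => //; rewrite -nk -nt ?ler_normD ?ler_normB.
Qed.

Lemma T1_values11 (R : realType) (X : normedModType R) :
  T1_values 1 1 X = T_values X.
Proof. by apply: eq_imagel => x _; rewrite !scale1r. Qed.

Lemma has_sup_T_values (R : realType) (X : normedModType R) :
  unit_sphere X !=set0 -> has_sup (T_values X).
Proof. by rewrite -T1_values11; exact: has_sup_T1_values. Qed.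

Lemma dim_ge_unit_sphere (R : realType) (X : normedModType R) (n : nat) :
  dim_ge X n.+1 -> unit_sphere X !=set0.
Proof.
move=> [v vfree].
have v0 : v ord0 != 0.
  apply/eqP => v0; have := vfree (fun i => (i == ord0)%:R).
  rewrite (bigD1 ord0)//= v0 scaler0 add0r big1; last first.
    by move=> i /negPf ->; rewrite scale0r.
  by move=> /(_ erefl ord0)/eqP; rewrite eqxx oner_eq0.
exists (`|v ord0|^-1 *: v ord0).
by rewrite /unit_sphere /= normrZ normfV normr_id mulVf ?normr_eq0.
Qed.

(* Main.v *)
Require Import Defs.
From HB Require Import structures.
From mathcomp Require Import all_boot all_order all_algebra.
From mathcomp Require Import all_classical all_reals all_analysis.
From mathcomp Require Import lra.
Import Order.TTheory GRing.Theory Num.Theory.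
Import numFieldNormedType.Exports.
Local Open Scope classical_set_scope.
Local Open Scope ring_scope.

(** Fix a nonzero vector [x] and write [f y = |x + y| * |x - y|].  The theorem follows
    from one fact ([norm_prod_le_on_sphere]): if [s >= |x|], then on the ball
    of radius [s] the function [f] is dominated by its values on the sphere of
    radius [s].  Applied to [k *: x], it shows that the constant with parameters
    [k, t] can only grow when [t] is raised to some [t' >= k]
    ([T1_const_le_r]).  Since the constant is symmetric in its parameters
    ([T1_constC]) and positively homogeneous, for [k <= t]
      [k * T = T1 k k <= T1 k t = T1 t k <= T1 t t = t * T].
    The comparison must be made between suprema: for a fixed pair of unit
    vectors the product need not grow with [t], as [x = (1, 1)],
    [y = (- (1 - a), - 1)] with [a] small show in the sup norm of the plane.

    To prove the fact, put [p = y + x] and [q = y - x] and push [y] in the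
    direction [d = p / |p| + q / |q|] until it reaches the sphere.  Neither
    [|p|] nor [|q|] decreases on the way ([ler_norm_bisector]): along [p] the
    first summand gains exactly as much as the second one can lose.  This
    argument fails if [p = 0] or [q = 0], when [f y = 0], and if [d = 0].  In
    the last case [p] and [q] point in opposite directions, so
    [|p| + |q| = |p - q| = 2 * |x|], and AM-GM gives
    [f y <= |x| ^+ 2 <= s ^+ 2].  For these exceptional [y] it remains to find
    a point of the sphere where [f] is at least [s ^+ 2].  Any [y] equidistant from [x] and [- x] will do,
    because [2 * |y| <= |x + y| + |x - y|]; in dimension at least 2 it exists
    by the intermediate value theorem on a path of the sphere that joins the
    directions of [x] and [- x] ([exists_isosceles]). *)

Section SphereDomination.
Context {R : realType} {X : normedModType R}.
Implicit Types (x y z p q : X) (s t r k : R).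

(** * Points equidistant from two opposite vectors *)

Lemma dim_ge2_not_in_line x : dim_ge X 2 -> exists z, forall a, z != a *: x.
Proof.
move=> [v vfree]; apply: contrapT => /forallNP H.
have inline i : exists a, v i = a *: x.
  have /existsNP[a /negP] := H (v i).
  by rewrite negbK => /eqP va; exists a.
have [a va] := inline ord0; have [b vb] := inline ord_max.
have v2 (c : 'I_2 -> R) : c ord0 * a + c ord_max * b = 0 -> forall i, c i = 0.
  move=> cab; apply: vfree.
  rewrite big_ord_recl big_ord1.
  have -> : lift ord0 ord0 = ord_max :> 'I_2 by apply: val_inj.
  by rewrite va vb !scalerA -scalerDl cab scale0r.
have := v2 (fun i => if i == ord0 then b else - a).
rewrite /= mulNr mulrC subrr => /(_ erefl) ba.
have b0 : b = 0 by have := ba ord0.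
have a0 : a = 0 by apply/eqP; rewrite -oppr_eq0; apply/eqP; have := ba ord_max.
have := v2 (fun=> 1); rewrite a0 b0 !mulr0 addr0 => /(_ erefl ord0)/eqP.
by rewrite oner_eq0.
Qed.

(** The path from [- x] to [x] through [z] misses the origin because [z] is not
    a multiple of [x].  Comparing [| |w| *: x + s *: w |] with
    [| |w| *: x - s *: w |] instead of normalizing [w] keeps divisions out of
    the function given to the intermediate value theorem. *)
Lemma exists_isosceles x s : dim_ge X 2 -> x != 0 -> 0 < s ->
  exists y, `|y| = s /\ `|x + y| = `|x - y|.
Proof.
move=> dimX x0 s0; have [z zx] := dim_ge2_not_in_line x dimX.
pose w t : X := t *: x + (1 - t ^+ 2) *: z.
have w0 t : w t != 0.
  apply/eqP => wt0; have [t1|t1] := eqVneq (1 - t ^+ 2) 0.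
    move: wt0; rewrite /w t1 scale0r addr0 => /eqP.
    rewrite scaler_eq0 (negPf x0) orbF => /eqP t0.
    by move: t1; rewrite t0 expr0n /= subr0 => /eqP; rewrite oner_eq0.
  have /negP := zx (- t / (1 - t ^+ 2)); apply; apply/eqP.
  apply: (scalerI t1); rewrite scalerA mulrCA divff// mulr1 scaleNr.
  by apply/eqP; rewrite -addr_eq0 addrC -/(w t) wt0.
have cw : continuous w.
  move=> t; apply: cvgD; first by apply: cvgZr_tmp; exact: cvg_id.
  apply: cvgZr_tmp; apply: cvgB; first exact: cvg_cst.
  exact: exprn_continuous.
pose g t := `| `|w t| *: x + s *: w t| - `| `|w t| *: x - s *: w t|.
have cg : continuous g.
  move=> t; have cnwx : `|w u| *: x @[u --> t] --> `|w t| *: x.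
    by apply: cvgZr_tmp; apply: cvg_norm; exact: cw.
  have csw : s *: w u @[u --> t] --> s *: w t by apply: cvgZl_tmp; exact: cw.
  by apply: cvgB; apply: cvg_norm; [exact: cvgD|exact: cvgB].
have g1 : 0 <= g 1.
  rewrite /g /w expr1n subrr scale0r addr0 scale1r -scalerDl -scalerBl.
  rewrite !normrZ subr_ge0 ler_wpM2r// (le_trans (ler_normB _ _))//.
  by rewrite normr_id [leRHS]ger0_norm ?addr_ge0 ?(ltW s0)// [`|s|]gtr0_norm.
have gN1 : g (- 1) = - g 1.
  rewrite /g /w sqrrN expr1n subrr !scale0r !addr0 scaleN1r scale1r normrN.
  by rewrite scalerN opprK opprB.
have [t _ gt0] : exists2 c, c \in `[-1, 1] & g c = 0.
  apply: IVT; first by lra.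
    exact: continuous_subspaceT.
  by rewrite gN1 ge_min le_max g1 oppr_le0 g1 orbT.
have nw0 : 0 < `|w t| by rewrite normr_gt0.
exists ((s / `|w t|) *: w t); split.
  by rewrite normrZ normrM normfV normr_id gtr0_norm// divfK// gt_eqF.
have wy : `|w t| *: ((s / `|w t|) *: w t) = s *: w t.
  by rewrite scalerA mulrC divfK// gt_eqF.
apply: (mulfI (lt0r_neq0 nw0)).
have pull v : `|w t| * `|v| = `| `|w t| *: v| by rewrite normrZ normr_id.
by rewrite !pull scalerDr scalerBr wy; apply/eqP; rewrite -subr_eq0; apply/eqP.
Qed.

Lemma exists_norm_prod_ge_sqr x s : dim_ge X 2 -> x != 0 -> 0 < s ->
  exists y, `|y| = s /\ s ^+ 2 <= `|x + y| * `|x - y|.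
Proof.
move=> dimX x0 s0; have [y [ys xy]] := exists_isosceles x s dimX x0 s0.
exists y; split=> //; rewrite -xy -expr2 ler_sqr ?nnegrE ?(ltW s0)//.
have : `|2 *: y| <= `|x + y| + `|x - y|.
  apply: le_trans (ler_normB _ _).
  by rewrite opprB addrC subrKA scaler_nat mulr2n.
by rewrite -xy normrZ ys ger0_norm//; lra.
Qed.

(** * Pushing a vector of the ball to the sphere *)

Definition direction p : X := `|p|^-1 *: p.

Lemma normZ_direction p r : p != 0 -> 0 <= r -> `|r *: direction p| = r.
Proof.
move=> p0 r0.
by rewrite !normrZ normfV normr_id mulVf ?normr_eq0// mulr1 ger0_norm.
Qed.

Lemma scale_direction p : p = `|p| *: direction p.
Proof.
have [->|p0] := eqVneq p 0; first by rewrite normr0 scale0r.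
by rewrite scalerA divff ?scale1r// normr_eq0.
Qed.

(** Along [direction p] the norm grows at unit speed, and the unit vector
    [direction q] cannot take away more than that. *)
Lemma ler_norm_bisector p q r : p != 0 -> q != 0 -> 0 <= r ->
  `|p| <= `|p + r *: (direction p + direction q)|.
Proof.
move=> p0 q0 r0.
have -> : p + r *: (direction p + direction q) =
    (`|p| + r) *: direction p + r *: direction q.
  by rewrite scalerDr addrA scalerDl -scale_direction.
have := lerB_normD ((`|p| + r) *: direction p) (r *: direction q).
by rewrite !normZ_direction ?addr_ge0// addrK.
Qed.

(** Opposite directions make the triangle inequality for [p - q] an equality,
    which turns [p - q = 2 *: x] into [|p| + |q| = 2 * |x|]. *)
Lemma norm_prod_opposite_directions x p q : p - q = 2 *: x ->
  direction p + direction q = 0 -> `|p| * `|q| <= `|x| ^+ 2.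
Proof.
move=> pq d0; have [->|p0] := eqVneq p 0; first by rewrite normr0 mul0r sqr_ge0.
have dq : direction q = - direction p.
  by apply/eqP; rewrite -addr_eq0 addrC d0.
have sum2 : `|p| + `|q| = 2 * `|x|.
  have : `|p - q| = `|p| + `|q|.
    rewrite {1}(scale_direction p) {1}(scale_direction q) dq.
    rewrite scalerN opprK -scalerDl.
    by rewrite normZ_direction ?addr_ge0.
  by rewrite pq normrZ ger0_norm// => <-.
have := sqr_ge0 (`|p| - `|q|); nra.
Qed.

Lemma ray_meets_sphere y d s : `|y| <= s -> d != 0 ->
  exists2 r, 0 <= r & `|y + r *: d| = s.
Proof.
move=> ys d0; have nd0 : 0 < `|d| by rewrite normr_gt0.
have s0 : 0 <= s := le_trans (normr_ge0 y) ys.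
(* At parameter [M] the displacement has length [2 * s], which exceeds [|y|]
   by at least [s]. *)
pose M := 2 * s / `|d|.
have M0 : 0 <= M by rewrite divr_ge0 ?mulr_ge0.
have endM : s <= `|y + M *: d|.
  have := lerB_normD (M *: d) y.
  rewrite normrZ ger0_norm// divfK ?gt_eqF// [_ + y]addrC.
  by apply: le_trans; lra.
have [r rM yrs] : exists2 r, r \in `[0, M] & `|y + r *: d| = s.
  apply: (@IVT R (fun r => `|y + r *: d|)) => //.
    apply: continuous_subspaceT => r; apply: cvg_norm.
    apply: cvgD; first exact: cvg_cst.
    by apply: cvgZr_tmp; exact: cvg_id.
  by rewrite scale0r addr0 ge_min le_max ys endM orbT.
by exists r => //; move: rM; rewrite in_itv /= => /andP[].
Qed.

Lemma norm_prod_le_on_sphere x y s : dim_ge X 2 -> x != 0 ->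
  `|x| <= s -> `|y| <= s ->
  exists y', `|y'| = s /\ `|x + y| * `|x - y| <= `|x + y'| * `|x - y'|.
Proof.
move=> dimX x0 xs ys.
have s0 : 0 < s by apply: lt_le_trans xs; rewrite normr_gt0.
have small : `|x + y| * `|x - y| <= `|x| ^+ 2 ->
    exists y', `|y'| = s /\ `|x + y| * `|x - y| <= `|x + y'| * `|x - y'|.
  move=> fy; have [y' [y's fy']] := exists_norm_prod_ge_sqr x s dimX x0 s0.
  exists y'; split=> //; apply: le_trans fy (le_trans _ fy').
  by rewrite ler_sqr ?nnegrE// ltW.
have [p0|p0] := eqVneq (y + x) 0.
  by apply: small; rewrite addrC p0 normr0 mul0r sqr_ge0.
have [q0|q0] := eqVneq (y - x) 0.
  by apply: small; rewrite [`|x - y|]distrC q0 normr0 mulr0 sqr_ge0.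
have [d0|d0] := eqVneq (direction (y + x) + direction (y - x)) 0.
  apply: small; rewrite addrC distrC.
  apply: norm_prod_opposite_directions d0.
  by rewrite opprB addrC subrKA scaler_nat mulr2n.
have [r r0 yrs] := ray_meets_sphere _ _ _ ys d0.
exists (y + r *: (direction (y + x) + direction (y - x))); split=> //.
rewrite (addrC x y) (distrC x y) (addrC x) (distrC x).
apply: ler_pM => //.
- by rewrite addrAC; exact: ler_norm_bisector.
- by rewrite addrAC [direction (y + x) + _]addrC; exact: ler_norm_bisector.
Qed.

(** * Comparison of the constants *)

Lemma T1_const_ge k t x y : `|x| = 1 -> `|y| = 1 ->
  Num.sqrt (`|k *: x + t *: y| * `|k *: x - t *: y|) <= T1_const k t X.
Proof.
move=> x1 y1; apply: ub_le_sup; last by exists (x, y).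
by apply: (has_sup_T1_values _ _ _).2; exists x.
Qed.

Lemma T1_const_le k t (b : R) : unit_sphere X !=set0 ->
  (forall x y, `|x| = 1 -> `|y| = 1 ->
     Num.sqrt (`|k *: x + t *: y| * `|k *: x - t *: y|) <= b) ->
  T1_const k t X <= b.
Proof.
move=> S0 kb; apply: ge_sup; first exact: (has_sup_T1_values _ _ S0).1.
by move=> _ [[x y] [/= x1 y1] <-]; exact: kb.
Qed.

Lemma T1_constC k t : T1_const k t X = T1_const t k X.
Proof.
rewrite /T1_const; congr sup.
by apply/seteqP; split=> _ [[x y] [/= x1 y1] <-]; exists (y, x) => //=;
  rewrite distrC addrC.
Qed.

(** [t *: y] lies in the ball of radius [t'], where moving it to the sphere costs
    nothing; [k <= t'] says that [k *: x] is short enough for that. *)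
Lemma T1_const_le_r k t t' : dim_ge X 2 -> 0 < k -> k <= t' -> `|t| <= t' ->
  T1_const k t X <= T1_const k t' X.
Proof.
move=> dimX k0 kt' tt'; apply: T1_const_le; first exact: dim_ge_unit_sphere dimX.
move=> x y x1 y1; have t'0 : 0 < t' := lt_le_trans k0 kt'.
have kx : `|k *: x| = k by rewrite normrZ x1 mulr1 gtr0_norm.
have kx0 : k *: x != 0 by rewrite -normr_gt0 kx.
have ty : `|t *: y| <= t' by rewrite normrZ y1 mulr1.
have [||y' [y't' le_prod]] := norm_prod_le_on_sphere (k *: x) (t *: y) t' dimX kx0.
- by rewrite kx.
- exact: ty.
apply: le_trans (T1_const_ge k t' x (t'^-1 *: y') x1 _).
  by rewrite scalerA divff ?gt_eqF// scale1r ler_wsqrtr.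
by rewrite normrZ normfV y't' gtr0_norm// mulVf ?gt_eqF.
Qed.

Lemma sqrt_norm_prod_scale k x y : 0 <= k ->
  Num.sqrt (`|k *: x + k *: y| * `|k *: x - k *: y|) =
  k * Num.sqrt (`|x + y| * `|x - y|).
Proof.
move=> k0; rewrite -scalerDr -scalerBr !normrZ mulrACA ger0_norm// -expr2.
by rewrite sqrtrM ?sqr_ge0// sqrtr_sqr ger0_norm.
Qed.

Lemma T1_const_diag k : unit_sphere X !=set0 -> 0 < k ->
  T1_const k k X = k * T_const X.
Proof.
move=> S0 k0; have TE : T_const X = T1_const 1 1 X.
  by rewrite /T_const /T1_const T1_values11.
apply/eqP; rewrite eq_le; apply/andP; split.
  apply: T1_const_le => // x y x1 y1; rewrite sqrt_norm_prod_scale ?(ltW k0)//.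
  by rewrite ler_pM2l// TE; have := T1_const_ge 1 1 x y x1 y1; rewrite !scale1r.
rewrite mulrC -ler_pdivlMr// TE; apply: T1_const_le => // x y x1 y1.
rewrite !scale1r ler_pdivlMr// mulrC -sqrt_norm_prod_scale ?(ltW k0)//.
exact: T1_const_ge.
Qed.

Lemma T1_const_bounds_le k t : dim_ge X 2 -> 0 < k -> k <= t ->
  k * T_const X <= T1_const k t X <= t * T_const X.
Proof.
move=> dimX k0 kt; have t0 : 0 < t := lt_le_trans k0 kt.
have S0 := dim_ge_unit_sphere dimX.
rewrite -!T1_const_diag//; apply/andP; split.
  by apply: T1_const_le_r => //; rewrite gtr0_norm.
by rewrite T1_constC; apply: T1_const_le_r => //; rewrite gtr0_norm.
Qed.

End SphereDomination.

Theorem theorem1 (R : realType) (X : completeNormedModType R)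
    (dimX : dim_ge X 2) (kappa tau : R) (kappa_gt0 : 0 < kappa)
    (tau_gt0 : 0 < tau) :
  Num.min kappa tau * T_const X <= T1_const kappa tau X /\
  T1_const kappa tau X <= Num.max kappa tau * T_const X.
Proof.
apply/andP; have [kt|tk] := leP kappa tau; first exact: T1_const_bounds_le.
by rewrite T1_constC; apply: T1_const_bounds_le => //; exact: ltW.
Qed.
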